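(* The two-input system \[ \dot{x}_1=u_1,\qquad \dot{x}_2=u_2,\qquad \dot{x}_3=x_1+\frac{u_2^2}{2u_1} \] with state $x=(x_1,x_2,x_3)$ and input $u=(u_1,u_2)$ (on the domain $u_1\neq 0$) is flat and admits the $(x,u,\dot u)$-flat output \[ y_1=\frac{u_2}{u_1}, \] \[ y_2=2x_2-\frac{2}{u_1}\left(x_1u_2-x_3\dot{u}_2\right)-2\frac{u_2}{u_1^2}\left(x_2\dot{u}_2+x_3\dot{u}_1\right)+\frac{u_2^2}{u_1^3}\left(x_1\dot{u}_2+2x_2\dot{u}_1\right)-\frac{1}{u_1^4}x_1\dot{u}_1u_2^3 . \]
   Context: Conventions. All functions are smooth, all distributions are assumed to have locally constant dimension, all statements are local, and only generic points are considered. Time derivatives. For a system $\dot x=f(x,u)$ with $x=(x_1,\ldots,x_n)$ and $u=(u_1,u_2)$, the time derivative of a function $h(x,u,\dot u,\ldots,u^{(k)})$ along the system is the function $\dot h=\sum_{i=1}^n f_i(x,u)\,\frac{\partial h}{\partial x_i}+\sum_{l=0}^{k}\sum_{j=1}^{2}u_j^{(l+1)}\frac{\partial h}{\partial u_j^{(l)}}$, where $x,u,\dot u,\ddot u,\ldots$ are treated as independent coordinates; $h^{(\beta)}$ denotes the $\beta$-th iterated time derivative. Flatness. The system $\dot x=f(x,u)$ is called flat if there exist two functions $y_j=\varphi_j(x,u,\dot u,\ldots,u^{(q)})$, $j=1,2$, and smooth functions $F_{x_i}$, $F_{u_j}$ such that locally $x_i=F_{x_i}(\varphi,\dot\varphi,\ldots,\varphi^{(r-1)})$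 for $i=1,\ldots,n$ and $u_j=F_{u_j}(\varphi,\dot\varphi,\ldots,\varphi^{(r)})$ for $j=1,2$. Then $y=\varphi=(\varphi_1,\varphi_2)$ is called an $(x,u,\dot u,\ldots,u^{(q)})$-flat output; for $q=1$ this is an $(x,u,\dot u)$-flat output. *)

(* Defs.v *)
From HB Require Import structures.
From mathcomp Require Import all_boot all_order all_algebra.
From mathcomp Require Import all_classical all_reals all_analysis.

Set Implicit Arguments.
Unset Strict Implicit.
Unset Printing Implicit Defensive.

Import Order.TTheory GRing.Theory Num.Theory.
Import numFieldNormedType.Exports.

Local Open Scope classical_set_scope.
Local Open Scope ring_scope.

(* C^k on U, meant for an open U. Between finite-dimensional spaces, asking
   for all directional derivatives (in constant directions v) amounts to asking
   for all partial derivatives. *)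
Fixpoint Ck_on (R : realType) (V W : normedModType R) (U : set V) (k : nat)
    (f : V -> W) {struct k} : Prop :=
  (forall x, U x -> {for x, continuous f}) /\
  (if k is k'.+1 then
     forall v : V, (forall x, U x -> derivable f x v) /\ Ck_on U k' ('D_v f)
   else True).

Definition smooth_on (R : realType) (V W : normedModType R) (U : set V)
    (f : V -> W) : Prop :=
  forall k, Ck_on U k f.

(* P holds at generic points of A: on an open subset of A that is dense in A. *)
Definition generically (T : topologicalType) (A : set T) (P : T -> Prop) :
    Prop :=
  exists O : set T,
    [/\ open O, O `<=` A, A `<=` closure O & forall z, O z -> P z].

(* Points (x, u, u', ..., u^(k)), with independent coordinates:
   z.1 0 i = x_i and z.2 l j = u_j^(l). All indices start at 0. *)
Notation jet R n k := ('rV[R]_n * 'M[R]_(k.+1, 2))%type (only parsing).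

(* Forgets u^(k+1), ..., u^(m); only meaningful for k <= m, in which case
   inord l : 'I_m.+1 has value l. *)
Definition trunc (R : realType) (n m k : nat) (z : jet R n m) : jet R n k :=
  (z.1, \matrix_(l < k.+1, j < 2) z.2 (inord l) j).

Section Flatness.
Variables (R : realType) (n : nat).

(* The system x' = f (x, u), considered for (x, u) in D. *)
Variables (D : set ('rV[R]_n * 'rV[R]_2)) (f : 'rV[R]_n * 'rV[R]_2 -> 'rV[R]_n).

Definition control_system : Prop := [/\ open D, D !=set0 & smooth_on D f].

Definition jet_xu (k : nat) (z : jet R n k) : 'rV[R]_n * 'rV[R]_2 :=
  (z.1, row 0 z.2).

Definition jet_dom (k : nat) : set (jet R n k) := [set z | D (jet_xu z)].

(* lift ord0 l : 'I_k.+2 has value l + 1. *)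
Definition time_deriv (k : nat) (h : jet R n k -> R) (z : jet R n k.+1) : R :=
  \sum_(i < n) f (jet_xu z) 0 i *
     'D_((delta_mx 0 i, 0) : jet R n k) h (trunc k z) +
  \sum_(l < k.+1) \sum_(j < 2) z.2 (lift ord0 l) j *
     'D_((0, delta_mx l j) : jet R n k) h (trunc k z).

Fixpoint time_derivn (q : nat) (h : jet R n q -> R) (b : nat) :
    jet R n (b + q)%N -> R :=
  match b return jet R n (b + q)%N -> R with
  | 0%N => h
  | b'.+1 => time_deriv (@time_derivn q h b')
  end.
Arguments time_derivn {q} h b z.

(* Row b of the matrix is (phi_1^(b), phi_2^(b)), for b = 0, ..., s - 1. *)
Definition output_jet (q : nat) (phi : 'I_2 -> jet R n q -> R) (s m : nat)
    (z : jet R n m) : 'M[R]_(s, 2) :=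
  \matrix_(b < s, j < 2) time_derivn (phi j) b (trunc (b + q)%N z).

(* phi is an (x, u, ..., u^(q))-flat output: for some r, near generic jets,
   x = Fx (phi, ..., phi^(r-1)) and u = Fu (phi, ..., phi^(r)) with smooth Fx, Fu.
   These derivatives of phi depend on u^(l) for l <= r + q only; the set
   trunc q @` V is open, trunc being a coordinate projection. *)
Definition flat_output (q : nat) (phi : 'I_2 -> jet R n q -> R) : Prop :=
  control_system /\
  exists r : nat,
    generically (@jet_dom (r + q)%N) (fun z0 => exists V : set (jet R n (r + q)%N),
      [/\ open V, V z0, V `<=` @jet_dom (r + q)%N,
          forall j, smooth_on (trunc q @` V) (phi j)
        & (exists (Wx : set 'M[R]_(r, 2)) (Fx : 'M[R]_(r, 2) -> 'rV[R]_n),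
             [/\ open Wx, smooth_on Wx Fx
               & forall z, V z ->
                   Wx (output_jet phi r z) /\
                   z.1 = Fx (output_jet phi r z)]) /\
          (exists (Wu : set 'M[R]_(r.+1, 2)) (Fu : 'M[R]_(r.+1, 2) -> 'rV[R]_2),
             [/\ open Wu, smooth_on Wu Fu
               & forall z, V z ->
                   Wu (output_jet phi r.+1 z) /\
                   row 0 z.2 = Fu (output_jet phi r.+1 z)])]).

Definition flat : Prop :=
  exists (q : nat) (phi : 'I_2 -> jet R n q -> R), flat_output phi.

End Flatness.

Arguments time_derivn {R n} f {q} h b z.

(* The numerals 0, 1, 2 used as indices below are elements of 'I_2 or 'I_3. *)
Definition example_dom (R : realType) : set ('rV[R]_3 * 'rV[R]_2) :=
  [set p : 'rV[R]_3 * 'rV[R]_2 | p.2 0 0 != 0].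

Definition example_rhs (R : realType) (p : 'rV[R]_3 * 'rV[R]_2) : 'rV[R]_3 :=
  let x1 := p.1 0 0 in let u1 := p.2 0 0 in let u2 := p.2 0 1 in
  \row_(i < 3) [:: u1; u2; x1 + u2 ^+ 2 / (2 * u1)]`_i.

Definition example_y1 (R : realType) (z : jet R 3 1) : R :=
  let u1 := z.2 0 0 in let u2 := z.2 0 1 in
  u2 / u1.

Definition example_y2 (R : realType) (z : jet R 3 1) : R :=
  let x1 := z.1 0 0 in let x2 := z.1 0 1 in let x3 := z.1 0 2 in
  let u1 := z.2 0 0 in let u2 := z.2 0 1 in
  let du1 := z.2 1 0 in let du2 := z.2 1 1 in
  2 * x2
  - 2 / u1 * (x1 * u2 - x3 * du2)
  - 2 * (u2 / u1 ^+ 2) * (x2 * du2 + x3 * du1)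
  + u2 ^+ 2 / u1 ^+ 3 * (x1 * du2 + 2 * x2 * du1)
  - 1 / u1 ^+ 4 * (x1 * du1 * u2 ^+ 3).

Definition example_output (R : realType) (j : 'I_2) : jet R 3 1 -> R :=
  if j == 0 then @example_y1 R else @example_y2 R.

(* Main.v *)
Require Import Defs.
From HB Require Import structures.
From mathcomp Require Import all_boot all_order all_algebra.
From mathcomp Require Import all_classical all_reals all_analysis.
From mathcomp Require Import ring.

Set Implicit Arguments.
Unset Strict Implicit.
Unset Printing Implicit Defensive.

Import Order.TTheory GRing.Theory Num.Theory.
Import numFieldNormedType.Exports.

Local Open Scope classical_set_scope.
Local Open Scope ring_scope.

(** Write w = y1 = u2 / u1. On the domain, y2 = A + w' B with A = 2 (x2 - w x1)
    and B = 2 x3 - 2 w x2 + w^2 x1. Along the system u2 = w u1, and therefore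
    A' = - 2 w' x1 and B' = 2 x1 - w' A: each differentiation of y2 produces
    combinations of A, B and x1 (and finally u1) whose coefficients depend on
    w, w', w'', ... only:
      y2'   = w'' B - w'^2 A,
      y2''  = w''' B - 3 w' w'' A + 2 (w'' + w'^3) x1,
      y2''' = w'''' B - (4 w' w''' + 3 w''^2) A + (4 w''' + 12 w'^2 w'') x1
              + 2 (w'' + w'^3) u1
    (lemmas [tder_y2], [tder_dy2], [tder_ddy2]). The pair y2, y2' is a linear
    system for (A, B) of determinant w'' + w'^3; where this does not vanish, A
    and B, then x1 from y2'', then x2 and x3 from A and B, and finally u1 from
    y2''' and u2 = w u1 are rational functions of y1, ..., y1'''' and
    y2, ..., y2''' (lemmas [eval_x_of] and [eval_u_of]). The condition is
    generic because w'' + w'^3 is affine in u2'' with slope 1 / u1 (lemmas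
    [gen_expr_shift] and [dense_generic_jets]).

    Every function in sight is rational in coordinates, so the analysis is
    carried out once, on syntactic rational expressions: evaluation turns the
    formal derivation [fder] into directional derivatives ([is_derive_eval]),
    hence smoothness ([Ck_eval]), and into time derivatives along the system
    ([time_deriv_eval], [time_derivn_eval]). What remains are field identities
    in which w, w', w'', ... are kept as unknowns; this is what makes y2'''
    tractable. *)

(** * Rational expressions and their formal derivations *)

Inductive rexpr (R I : Type) :=
  | Var of I
  | Cst of R
  | Add of rexpr R I & rexpr R I
  | Mul of rexpr R I & rexpr R I
  | Inv of rexpr R I.
Arguments Var {R I}.
Arguments Cst {R I}.

Declare Scope rexpr_scope.
Delimit Scope rexpr_scope with RE.
Bind Scope rexpr_scope with rexpr.
Notation "a + b" := (Add a b) : rexpr_scope.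
Notation "a * b" := (Mul a b) : rexpr_scope.
Notation "a - b" := (Add a (Mul (Cst (- 1)) b)) : rexpr_scope.
Notation "a / b" := (Mul a (Inv b)) : rexpr_scope.

Section Expressions.
Variables (R : realType) (I : Type).
Implicit Types (c : I -> R) (e : rexpr R I) (d : I -> rexpr R I).

Fixpoint eval c e : R :=
  match e with
  | Var i => c i
  | Cst a => a
  | Add e1 e2 => eval c e1 + eval c e2
  | Mul e1 e2 => eval c e1 * eval c e2
  | Inv e1 => (eval c e1)^-1
  end.

(** No division by zero occurs. *)
Fixpoint wd c e : bool :=
  match e with
  | Var _ | Cst _ => true
  | Add e1 e2 | Mul e1 e2 => wd c e1 && wd c e2
  | Inv e1 => wd c e1 && (eval c e1 != 0)
  end.

Fixpoint all_vars (P : pred I) e : bool :=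
  match e with
  | Var i => P i
  | Cst _ => true
  | Add e1 e2 | Mul e1 e2 => all_vars P e1 && all_vars P e2
  | Inv e1 => all_vars P e1
  end.

(** The derivation that extends d from the variables. With d constant it is a
    directional derivative; with d given by the equations of motion it is the
    total time derivative. *)
Fixpoint fder d e : rexpr R I :=
  match e with
  | Var i => d i
  | Cst _ => Cst 0
  | Add e1 e2 => fder d e1 + fder d e2
  | Mul e1 e2 => fder d e1 * e2 + e1 * fder d e2
  | Inv e1 => Cst (- 1) * fder d e1 / e1 / e1
  end%RE.

Lemma eval_ext (P : pred I) c1 c2 e : all_vars P e ->
  (forall i, P i -> c1 i = c2 i) -> eval c1 e = eval c2 e.
Proof.
move=> + c12; elim: e => //= [e1 IH1 e2 IH2|e1 IH1 e2 IH2|e1 IH1].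
- by case/andP=> /IH1 -> /IH2 ->.
- by case/andP=> /IH1 -> /IH2 ->.
- by move=> /IH1 ->.
Qed.

Lemma eval_fder_ext (P : pred I) c1 c2 d1 d2 e : all_vars P e ->
  (forall i, P i -> c1 i = c2 i) ->
  (forall i, P i -> eval c1 (d1 i) = eval c2 (d2 i)) ->
  eval c1 (fder d1 e) = eval c2 (fder d2 e).
Proof.
move=> + c12 d12; elim: e => //= [e1 IH1 e2 IH2|e1 IH1 e2 IH2|e1 IH1].
- by case/andP=> /IH1 -> /IH2 ->.
- by case/andP=> P1 P2; rewrite IH1 // IH2 // !(eval_ext _ c12).
- by move=> P1; rewrite IH1 // (eval_ext P1 c12).
Qed.

Lemma all_vars_fder (P Q : pred I) d e : subpred P Q ->
  (forall i, P i -> all_vars Q (d i)) -> all_vars P e -> all_vars Q (fder d e).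
Proof.
move=> PQ dQ.
have sub e1 : all_vars P e1 -> all_vars Q e1.
  elim: e1 => //= [e1 IH1 e2 IH2|e1 IH1 e2 IH2].
  - by case/andP=> /IH1 -> /IH2 ->.
  - by case/andP=> /IH1 -> /IH2 ->.
elim: e => //= [e1 IH1 e2 IH2|e1 IH1 e2 IH2|e1 IH1].
- by case/andP=> /IH1 -> /IH2 ->.
- by case/andP=> P1 P2; rewrite IH1 // IH2 // !sub.
- by move=> P1; rewrite IH1 // sub.
Qed.

Lemma wd_fder c d e : (forall i, wd c (d i)) -> wd c e -> wd c (fder d e).
Proof.
move=> dP; elim: e => //= [e1 IH1 e2 IH2|e1 IH1 e2 IH2|e1 IH1].
- by case/andP=> /IH1 -> /IH2 ->.
- by case/andP=> P1 P2; rewrite IH1 // IH2 // P1 P2.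
- by case/andP=> P1 ->; rewrite IH1 // P1.
Qed.

(** The derivative is linear in the direction: this collapses the sum of partial
    derivatives in a time derivative into a single formal derivation. *)
Lemma eval_fder_sum (J : finType) c (a : J -> R) (c' : J -> I -> R) e :
  \sum_j a j * eval c (fder (fun i => Cst (c' j i)) e) =
  eval c (fder (fun i => Cst (\sum_j a j * c' j i)) e).
Proof.
elim: e => //= [_|e1 IH1 e2 IH2|e1 IH1 e2 IH2|e1 IH1].
- by rewrite big1 // => j _; rewrite mulr0.
- by rewrite -IH1 -IH2 -big_split; apply: eq_bigr => j _; rewrite mulrDr.
- rewrite -IH1 -IH2 mulr_suml mulr_sumr -big_split.
  by apply: eq_bigr => j _ /=; ring.
- rewrite -IH1 mulr_sumr !mulr_suml.
  by apply: eq_bigr => j _ /=; ring.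
Qed.

(** * Smoothness of rational functions *)

Section Calculus.
Variables (V : normedModType R) (c : V -> I -> R).

Lemma is_derive_eval (x v : V) (c' : I -> R) e :
  (forall i, is_derive x v (c ^~ i) (c' i)) -> wd (c x) e ->
  is_derive x v (fun y => eval (c y) e)
    (eval (c x) (fder (fun i => Cst (c' i)) e)).
Proof.
move=> dc; elim: e => //= [a _|e1 IH1 e2 IH2|e1 IH1 e2 IH2|e1 IH1].
- exact: is_derive_cst.
- by case/andP=> /IH1 d1 /IH2 d2; exact: is_deriveD.
- case/andP=> /IH1 d1 /IH2 d2.
  apply: is_derive_eq (is_deriveM d1 d2) _.
  by rewrite /GRing.scale /=; ring.
- case/andP=> /IH1 [d1 d1E] e1x.
  apply: DeriveDef; first exact: derivableV.
  rewrite deriveV // d1E /GRing.scale /=.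
  by rewrite expr2 invfM; ring.
Qed.

Hypothesis c_cont : forall i, continuous (c ^~ i).

Lemma continuous_eval x e :
  wd (c x) e -> {for x, continuous (fun y => eval (c y) e)}.
Proof.
elim: e => //= [i _|a _|e1 IH1 e2 IH2|e1 IH1 e2 IH2|e1 IH1].
- exact: c_cont.
- exact: cvg_cst.
- by case/andP=> /IH1 d1 /IH2 d2; exact: cvgD.
- by case/andP=> /IH1 d1 /IH2 d2; exact: cvgM.
- by case/andP=> /IH1 d1 e1x; exact: cvgV.
Qed.

Lemma open_wd e : open [set x | wd (c x) e].
Proof.
elim: e => /= [i|a|e1 IH1 e2 IH2|e1 IH1 e2 IH2|e1 IH1].
- by rewrite (_ : [set _ | _] = setT); [exact: openT|apply/seteqP].
- by rewrite (_ : [set _ | _] = setT); [exact: openT|apply/seteqP].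
- rewrite (_ : [set _ | _] = [set x | wd (c x) e1] `&` [set x | wd (c x) e2]).
    exact: openI.
  by apply/seteqP; split=> x /= /andP.
- rewrite (_ : [set _ | _] = [set x | wd (c x) e1] `&` [set x | wd (c x) e2]).
    exact: openI.
  by apply/seteqP; split=> x /= /andP.
- rewrite openE => x /= /andP[wx nx]; rewrite /interior /=.
  have := continuous_eval wx => /cvgr_neq0 /(_ nx) near1.
  have near2 : \forall y \near x, wd (c y) e1.
    by move: IH1; rewrite openE => /(_ _ wx).
  by near=> y; apply/andP; split; near: y.
Unshelve. all: by end_near. Qed.

Hypothesis c_lin : forall i x v, is_derive x v (c ^~ i) (c v i).

Lemma is_deriveZl (W : normedModType R) (g : V -> R) (x v : V) dg (w : W) :
  is_derive x v g dg -> is_derive x v (fun y => g y *: w) (dg *: w).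
Proof.
move=> [gx <-].
have : (fun h => h^-1 *: (((fun y => g y *: w) \o shift x) (h *: v) - g x *: w))
         @ 0^' --> 'D_v g x *: w.
  rewrite (_ : (fun h => _) =
    (fun h => (h^-1 *: ((g \o shift x) (h *: v) - g x)) *: w)).
    by apply: cvgZr_tmp; exact: gx.
  by apply/funext => h /=; rewrite -scalerBl scalerA.
move=> cv; apply: DeriveDef; first by apply/cvg_ex; exists ('D_v g x *: w).
exact: cvg_lim cv.
Qed.

(** Directional derivatives of a rational function with linear coordinates are
    again rational, with the same denominators up to powers, so the induction on
    k runs over all expressions. It also runs over all f that agree with the
    expression on the open set U, because 'D_v f is known to agree with the
    formal derivative there only. *)
Lemma Ck_eval (W : normedModType R) (U : set V) p (w : 'I_p -> W) k
    (e : 'I_p -> rexpr R I) (f : V -> W) : open U ->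
  (forall x, U x -> forall i, wd (c x) (e i)) ->
  (forall x, U x -> f x = \sum_i eval (c x) (e i) *: w i) -> Ck_on U k f.
Proof.
move=> oU; elim: k e f => [|k IH] e f eU fE.
all: have fnear x : U x -> \forall y \near x,
    \sum_i eval (c y) (e i) *: w i = f y
  by move=> Ux; near=> y; rewrite fE //; near: y; exact: open_nbhs_nbhs.
all: have fcont x : U x -> {for x, continuous f}.
1, 3: move=> Ux; rewrite /prop_for /continuous_at fE //.
1, 2: apply: (cvg_trans (near_eq_cvg (fnear x Ux))).
1, 2: apply: (cvg_big add_continuous) => i _; apply: cvgZr_tmp.
1, 2: by apply: continuous_eval => //; exact: (eU _ Ux).
  by [].
split=> // v.
have fD x : U x -> is_derive x v f
  (\sum_i eval (c x) (fder (fun j => Cst (c v j)) (e i)) *: w i).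
  move=> Ux; apply: near_eq_is_derive (fnear x Ux) _.
  rewrite (_ : (fun _ => _) = \sum_i (fun y => eval (c y) (e i) *: w i)).
    apply: is_derive_sum => i; apply: is_deriveZl; apply: is_derive_eval.
    exact: (eU _ Ux).
  by apply/funext => y; rewrite fct_sumE.
split=> [x /fD[]//|].
apply: (IH (fun i => fder (fun j => Cst (c v j)) (e i))) => x Ux.
  by move=> i; apply: wd_fder => //; exact: (eU _ Ux).
by case: (fD x Ux).
Unshelve. all: by end_near. Qed.
End Calculus.
End Expressions.

Lemma Ck_on_subset (R : realType) (V W : normedModType R) (U U' : set V) k
    (f : V -> W) :
  U `<=` U' -> Ck_on U' k f -> Ck_on U k f.
Proof.
move=> UU; elim: k f => [|k IH] f [cf df]; split=> //.
1, 2: by move=> x Ux; exact: cf _ (UU _ Ux).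
move=> v; have [dv Cv] := df v; split; last exact: IH.
by move=> x Ux; exact: dv _ (UU _ Ux).
Qed.

(** The difference quotient of a linear form is constant. *)
Lemma is_derive_linear (R : realType) (V : normedModType R) (g : V -> R)
    (x v : V) : (forall a y z, g (a *: y + z) = a * g y + g z) ->
  is_derive x v g (g v).
Proof.
move=> glin.
have quotE : \forall h \near 0^', g v = h^-1 *: ((g \o shift x) (h *: v) - g x).
  near=> h; rewrite /= glin addrK /GRing.scale /= mulrA mulVf ?mul1r //.
  near: h; exact: nbhs_dnbhs_neq.
have cv : h^-1 *: ((g \o shift x) (h *: v) - g x) @[h --> 0^'] --> g v.
  exact: cvg_trans (near_eq_cvg quotE) (cvg_cst _).
by apply: DeriveDef; [apply/cvg_ex; exists (g v)|exact: cvg_lim cv].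
Unshelve. all: by end_near. Qed.

(** * Time derivatives of rational functions on jets *)

Section Jets.
Variables (R : realType) (n : nat).

(** All jet spaces share one set of variables, inl i for x_i and inr (l, j) for
    u_j^(l), so that one expression can be evaluated on jets of any order. For
    l > k the value is the one for l = 0; [order_le] excludes such variables. *)
Definition jcoord k (z : jet R n k) (i : 'I_n + nat * 'I_2) : R :=
  match i with inl i => z.1 0 i | inr (l, j) => z.2 (inord l) j end.

Definition order_le k (i : 'I_n + nat * 'I_2) : bool :=
  if i is inr (l, _) then (l <= k)%N else true.

Lemma jcoord_continuous k i : continuous (@jcoord k ^~ i).
Proof.
case: i => [i|[l j]] z.
- apply: (@cvg_comp _ _ _ fst (fun m : 'rV[R]_n => m 0 i) _ (nbhs z.1)).
    exact: cvg_fst.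
  exact: coord_continuous.
- apply: (@cvg_comp _ _ _ snd (fun m : 'M[R]_(k.+1, 2) => m (inord l) j) _
    (nbhs z.2)).
    exact: cvg_snd.
  exact: coord_continuous.
Qed.

Lemma is_derive_jcoord k i (x v : jet R n k) :
  is_derive x v (@jcoord k ^~ i) (jcoord v i).
Proof.
by apply: is_derive_linear => a y z; case: i => [i|[l j]]; rewrite /= !mxE.
Qed.

Lemma jcoord_trunc m k (z : jet R n m) i :
  (k <= m)%N -> order_le k i -> jcoord (trunc k z) i = jcoord z i.
Proof. by move=> km; case: i => [i|[l j]] //= lk; rewrite mxE inordK. Qed.

Variables (f : 'rV[R]_n * 'rV[R]_2 -> 'rV[R]_n).

Definition prolong (F : 'I_n -> rexpr R ('I_n + nat * 'I_2))
    (i : 'I_n + nat * 'I_2) : rexpr R ('I_n + nat * 'I_2) :=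
  match i with inl i => F i | inr (l, j) => Var (inr (l.+1, j)) end.

(** The time derivative at z is the derivative of h at the truncated jet in the
    direction (f, u', ..., u^(k+1)), whose coordinates are the values at z of
    [prolong F]. *)
Lemma time_deriv_eval F k (h : jet R n k -> R) e (z : jet R n k.+1) :
  (forall i, eval (jcoord z) (F i) = f (jet_xu z) 0 i) ->
  all_vars (order_le k) e -> wd (jcoord (trunc k z)) e ->
  (\forall y \near trunc k z, eval (jcoord y) e = h y) ->
  time_deriv f h z = eval (jcoord z) (fder (prolong F) e).
Proof.
move=> FE ek wde hE.
have DE v : 'D_v h (trunc k z) =
    eval (jcoord (trunc k z)) (fder (fun i => Cst (jcoord v i)) e).
  apply: (@derive_val _ _ _ _ _ _ _ (near_eq_is_derive hE _)).
  by apply: is_derive_eval wde => i; exact: is_derive_jcoord.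
rewrite /time_deriv pair_big /=.
pose a (J : 'I_n + 'I_k.+1 * 'I_2) := match J with
  inl i => f (jet_xu z) 0 i | inr (l, j) => z.2 (lift ord0 l) j end.
pose V (J : 'I_n + 'I_k.+1 * 'I_2) : jet R n k := match J with
  inl i => (delta_mx 0 i, 0) | inr (l, j) => (0, delta_mx l j) end.
transitivity (\sum_j a j * 'D_(V j) h (trunc k z)).
  by rewrite big_sumType /=; congr (_ + _); apply: eq_bigr => -[].
under eq_bigr do rewrite DE.
rewrite eval_fder_sum; apply: eval_fder_ext ek _ _ => i ik.
  by rewrite jcoord_trunc.
rewrite big_sumType /=; case: i ik => [i|[l j]] /= lk.
- rewrite FE (bigD1 i) //= mxE !eqxx mulr1 !big1 ?addr0 //.
    by case=> l j _; rewrite mxE mulr0.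
  by move=> i' i'i; rewrite mxE eq_sym (negbTE i'i) mulr0.
- rewrite big1 ?add0r; last by move=> i _; rewrite mxE mulr0.
  rewrite (bigD1 (inord l, j)) //= mxE !eqxx mulr1 big1 ?addr0.
    by congr (z.2 _ _); apply/eqP; rewrite -val_eqE /= /bump !inordK.
  move=> [l' j'] lj /=; rewrite mxE; case: andP => [[/eqP l'E /eqP j'E]|_].
    by rewrite -l'E -j'E eqxx in lj.
  by rewrite mulr0.
Qed.
End Jets.

(** * Rational functions along the example system *)

Section Example.
Variable R : realType.

Notation ivar := ('I_3 + nat * 'I_2)%type.
Notation expr := (rexpr R ivar).
Implicit Types (e : expr) (c : ivar -> R).

Definition x_ (i : 'I_3) : expr := Var (inl i).
Definition u_ (l : nat) (j : 'I_2) : expr := Var (inr (l, j)).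

Definition rhs_expr (i : 'I_3) : expr :=
  nth (Cst 0) [:: u_ 0 0; u_ 0 1;
                  x_ 0 + u_ 0 1 * u_ 0 1 / (Cst 2 * u_ 0 0)]%RE i.

Notation tder := (fder (prolong rhs_expr)).

(** Its denominators are nonzero wherever u1 is. *)
Definition regular e :=
  forall c, c (inr (0%N, 0)) != 0 -> wd c e.

Lemma rhs_exprE k (z : jet R 3 k) i :
  eval (jcoord z) (rhs_expr i) = example_rhs (jet_xu z) 0 i.
Proof.
have inord0 : inord 0 = 0 :> 'I_k.+1 by apply: val_inj; rewrite /= inordK.
rewrite /rhs_expr /example_rhs mxE.
by case: i => [[|[|[|//]]] ?] /=; rewrite inord0 !mxE ?expr2.
Qed.

Lemma wd_rhs c i : c (inr (0%N, 0)) != 0 -> wd c (rhs_expr i).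
Proof.
by case: i => [[|[|[|//]]] ?] //= u0; rewrite mulf_neq0 // pnatr_eq0.
Qed.

Lemma all_vars_rhs k i : all_vars (order_le k) (rhs_expr i).
Proof. by case: i => [[|[|[|//]]] ?]. Qed.

Lemma regular_tder e : regular e -> regular (tder e).
Proof.
move=> re c u0; apply: wd_fder; last exact: re.
by case=> [i|[l j]] //=; exact: wd_rhs.
Qed.

Lemma order_tder k e :
  all_vars (order_le k) e -> all_vars (order_le k.+1) (tder e).
Proof.
apply: all_vars_fder; first by case=> [//|[l j]] /=; exact: leqW.
by case=> [i _|[l j]] //=; exact: all_vars_rhs.
Qed.

(** Expressions that define the same function for u1 <> 0 have the same time
    derivative: both are derivatives at 0 of their restrictions to a line in the
    direction of motion, on which u1 stays nonzero near 0. Hence the derivatives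
    of y2 can be simplified before differentiating again. *)
Lemma tder_congr e1 e2 : regular e1 -> regular e2 ->
  (forall c, c (inr (0%N, 0)) != 0 -> eval c e1 = eval c e2) ->
  forall c, c (inr (0%N, 0)) != 0 -> eval c (tder e1) = eval c (tder e2).
Proof.
move=> r1 r2 e12 c u0.
pose c' i := eval c (prolong rhs_expr i).
pose C (t : R) i := c i + t * c' i.
have C0 i : C 0 i = c i by rewrite /C mul0r addr0.
have dC i : is_derive (0 : R) (1 : R) (C ^~ i) (c' i).
  have := is_deriveD (is_derive_cst (c i) (0 : R) 1)
    (is_deriveZl (c' i) (is_derive_id (0 : R) 1)).
  by rewrite add0r scale1r.
have dE e : regular e -> is_derive (0 : R) (1 : R) (fun t => eval (C t) e)
    (eval c (tder e)).
  move=> re; apply: is_derive_eq.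
    by apply: is_derive_eval dC _; apply: re; rewrite C0.
  have eT : all_vars predT e by elim: e {re} => //= ? -> ? ->.
  by apply: eval_fder_ext eT _ _.
have near12 : \forall t \near (0 : R), eval (C t) e1 = eval (C t) e2.
  near=> t; apply: e12; near: t.
  have : {for 0, continuous (C ^~ (inr (0%N, 0)))}.
    apply: differentiable_continuous; apply/derivable1_diffP.
    by case: (dC (inr (0%N, 0))).
  by move/cvgr_neq0; apply; rewrite C0.
case: (dE _ r1) => _ <-; case: (dE _ r2) => _ <-.
exact: near_eq_derive near12.
Unshelve. all: by end_near. Qed.

Lemma jcoord0 k (z : jet R 3 k) j : jcoord z (inr (0%N, j)) = z.2 0 j.
Proof. by rewrite /=; congr (z.2 _ _); apply: val_inj; rewrite /= inordK. Qed.

Lemma example_jet_domE k (z : jet R 3 k) :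
  jet_dom (@example_dom R) z <-> jcoord z (inr (0%N, 0)) != 0.
Proof. by rewrite jcoord0 /jet_dom /example_dom /= mxE. Qed.

Lemma open_example_jet_dom k : open (@jet_dom R 3 (@example_dom R) k).
Proof.
rewrite (_ : @jet_dom R 3 _ k = [set z | wd (jcoord z) (Inv (u_ 0 0))]).
  by apply: open_wd => i; exact: jcoord_continuous.
by apply/seteqP; split=> z /example_jet_domE.
Qed.

Lemma time_derivn_eval q (h : jet R 3 q -> R) e b (z : jet R 3 (b + q)) :
  (forall z, jet_dom (@example_dom R) z -> h z = eval (jcoord z) e) ->
  all_vars (order_le q) e -> regular e ->
  jet_dom (@example_dom R) z ->
  time_derivn (@example_rhs R) h b z = eval (jcoord z) (iter b tder e).
Proof.
move=> hE oe re.
have ob a : all_vars (order_le (a + q)) (iter a tder e).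
  by elim: a => //= a; exact: order_tder.
have rb a : regular (iter a tder e).
  by elim: a => //= a; exact: regular_tder.
elim: b z => [|b IH] z zD /=; first exact: hE.
have tD : jet_dom (@example_dom R) (trunc (b + q) z).
  by apply/example_jet_domE; rewrite jcoord_trunc //; exact/example_jet_domE.
apply: time_deriv_eval => //.
- by move=> i; exact: rhs_exprE.
- by apply: rb; exact/example_jet_domE.
- near=> y; rewrite IH //; near: y.
  by apply: open_nbhs_nbhs; split => //; exact: open_example_jet_dom.
Unshelve. all: by end_near. Qed.

End Example.

(** * The successive derivatives of the output *)

Section FlatOutput.
Variable R : realType.
Notation ivar := ('I_3 + nat * 'I_2)%type.
Notation expr := (rexpr R ivar).
Notation tder := (fder (prolong (@rhs_expr R))).
Notation x_ := (@x_ R).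
Notation u_ := (@u_ R).
Implicit Types (c : ivar -> R).

Definition y1_expr : expr := (u_ 0 1 / u_ 0 0)%RE.

(** The b-th time derivative of w. *)
Definition slope b : expr := iter b tder y1_expr.

(** Since u2 = w u1, the input cancels from the time derivatives of A and B. *)
Definition A_expr : expr := (Cst 2 * (x_ 1 - slope 0 * x_ 0))%RE.

Definition B_expr : expr :=
  (Cst 2 * x_ 2 - Cst 2 * slope 0 * x_ 1 + slope 0 * slope 0 * x_ 0)%RE.

Definition y2_expr : expr := (A_expr + slope 1 * B_expr)%RE.
Definition dy2_expr : expr :=
  (slope 2 * B_expr - slope 1 * slope 1 * A_expr)%RE.
Definition ddy2_expr : expr :=
  (slope 3 * B_expr - Cst 3 * slope 1 * slope 2 * A_expr
   + Cst 2 * (slope 2 + slope 1 * slope 1 * slope 1) * x_ 0)%RE.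
Definition dddy2_expr : expr :=
  (slope 4 * B_expr
   - (Cst 4 * slope 1 * slope 3 + Cst 3 * slope 2 * slope 2) * A_expr
   + (Cst 4 * slope 3 + Cst 12 * slope 1 * slope 1 * slope 2) * x_ 0
   + Cst 2 * (slope 2 + slope 1 * slope 1 * slope 1) * u_ 0 0)%RE.

Lemma tder_slope b : tder (slope b) = slope b.+1. Proof. by []. Qed.

Lemma slope0_eval c : c (inr (0%N, 0)) != 0 ->
  c (inr (0%N, 1)) = eval c (slope 0) * c (inr (0%N, 0)).
Proof. by move=> u0; rewrite /slope /= divfK. Qed.

Lemma regular_slope b : regular (slope b).
Proof.
elim: b => [c /= -> //|b]; exact: regular_tder.
Qed.

(** Here and in the next two lemmas the sequence of derivatives of w is replaced
    by an arbitrary one, known only through s (b + 1) = (s b)' and u2 = s 0 u1;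
    otherwise the identity would be expanded in the coordinates u_j^(l). *)
Lemma tder_y2 c : c (inr (0%N, 0)) != 0 ->
  eval c (tder y2_expr) = eval c dy2_expr.
Proof.
move=> u0; have s0 := slope0_eval u0.
rewrite /y2_expr /dy2_expr /A_expr /B_expr.
move: slope tder_slope s0 => s ds s0.
by rewrite /= !ds /rhs_expr /= s0; field.
Qed.

Lemma tder_dy2 c : c (inr (0%N, 0)) != 0 ->
  eval c (tder dy2_expr) = eval c ddy2_expr.
Proof.
move=> u0; have s0 := slope0_eval u0.
rewrite /dy2_expr /ddy2_expr /A_expr /B_expr.
move: slope tder_slope s0 => s ds s0.
by rewrite /= !ds /rhs_expr /= s0; field.
Qed.

Lemma tder_ddy2 c : c (inr (0%N, 0)) != 0 ->
  eval c (tder ddy2_expr) = eval c dddy2_expr.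
Proof.
move=> u0; have s0 := slope0_eval u0.
rewrite /ddy2_expr /dddy2_expr /A_expr /B_expr.
move: slope tder_slope s0 => s ds s0.
by rewrite /= !ds /rhs_expr /= s0; field.
Qed.

Lemma regular_y2 : regular y2_expr.
Proof.
rewrite /y2_expr /A_expr /B_expr; move: slope regular_slope => s rs c u0.
by rewrite /= !rs.
Qed.

Lemma regular_dy2 : regular dy2_expr.
Proof.
rewrite /dy2_expr /A_expr /B_expr; move: slope regular_slope => s rs c u0.
by rewrite /= !rs.
Qed.

Lemma regular_ddy2 : regular ddy2_expr.
Proof.
rewrite /ddy2_expr /A_expr /B_expr; move: slope regular_slope => s rs c u0.
by rewrite /= !rs.
Qed.

Definition output_expr (j : 'I_2) : expr := if j == 0 then y1_expr else y2_expr.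

Lemma regular_output j : regular (output_expr j).
Proof.
rewrite /output_expr; case: ifP => _; first exact: (regular_slope 0).
exact: regular_y2.
Qed.

Lemma output_derivs c : c (inr (0%N, 0)) != 0 ->
  [/\ eval c (iter 1 tder y2_expr) = eval c dy2_expr,
      eval c (iter 2 tder y2_expr) = eval c ddy2_expr &
      eval c (iter 3 tder y2_expr) = eval c dddy2_expr].
Proof.
have d1 : forall c, c (inr (0%N, 0)) != 0 ->
  eval c (iter 1 tder y2_expr) = eval c dy2_expr by exact: tder_y2.
have d2 : forall c, c (inr (0%N, 0)) != 0 ->
  eval c (iter 2 tder y2_expr) = eval c ddy2_expr.
  move=> c' u0; rewrite -tder_dy2 //; apply: tder_congr u0 => //.
    by apply: regular_tder; exact: regular_y2.
  exact: regular_dy2.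
move=> u0; split; [exact: d1|exact: d2|].
rewrite -tder_ddy2 //; apply: tder_congr u0 => //.
  by do 2!apply: regular_tder; exact: regular_y2.
exact: regular_ddy2.
Qed.

Lemma example_outputE j (z : jet R 3 1) : jet_dom (@example_dom R) z ->
  example_output j z = eval (jcoord z) (output_expr j).
Proof.
move=> /example_jet_domE u0; rewrite /example_output /output_expr.
have i0 : inord 0 = 0 :> 'I_2 by apply: val_inj; rewrite /= inordK.
have i1 : inord 1 = 1 :> 'I_2 by apply: val_inj; rewrite /= inordK.
case: ifP => _; first by rewrite /example_y1 /= i0.
move: u0; rewrite /example_y2 /slope /= i0 i1 => u0.
by field.
Qed.

End FlatOutput.

(** * State and input from the output *)

Section Inversion.
Variable R : realType.
Notation jvar := (nat * 'I_2)%type.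
Implicit Types c : jvar -> R.

(** Row b of y holds the b-th derivatives of the two outputs, so the variable
    (b, j) stands for y_j^(b). *)
Definition ycoord s (y : 'M[R]_(s.+1, 2)) (i : jvar) : R := y (inord i.1) i.2.

Let w l : rexpr R jvar := Var (l, 0).
Let y l : rexpr R jvar := Var (l, 1).

(** The determinant of the linear system for A and B formed by y2 and y2'. *)
Definition det_expr : rexpr R jvar := (w 2 + w 1 * w 1 * w 1)%RE.
Definition B_of : rexpr R jvar := ((y 1 + w 1 * w 1 * y 0) / det_expr)%RE.
Definition A_of : rexpr R jvar := ((w 2 * y 0 - w 1 * y 1) / det_expr)%RE.
Definition x1_of : rexpr R jvar :=
  ((y 2 - w 3 * B_of + Cst 3 * w 1 * w 2 * A_of) / (Cst 2 * det_expr))%RE.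
Definition x2_of : rexpr R jvar := (A_of / Cst 2 + w 0 * x1_of)%RE.
Definition x3_of : rexpr R jvar :=
  (B_of / Cst 2 + w 0 * x2_of - w 0 * w 0 * x1_of / Cst 2)%RE.
Definition u1_of : rexpr R jvar :=
  ((y 3 - w 4 * B_of + (Cst 4 * w 1 * w 3 + Cst 3 * w 2 * w 2) * A_of
    - (Cst 4 * w 3 + Cst 12 * w 1 * w 1 * w 2) * x1_of)
   / (Cst 2 * det_expr))%RE.
Definition u2_of : rexpr R jvar := (w 0 * u1_of)%RE.

Definition x_of (i : 'I_3) := nth (Cst 0) [:: x1_of; x2_of; x3_of] i.
Definition u_of (j : 'I_2) := nth (Cst 0) [:: u1_of; u2_of] j.

Lemma wd_x_of c i : eval c det_expr != 0 -> wd c (x_of i).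
Proof.
move=> d; case: i => [[|[|[|//]]] ?] /=; rewrite d ?mulf_neq0 //= ?pnatr_eq0 //.
Qed.

Lemma wd_u_of c i : eval c det_expr != 0 -> wd c (u_of i).
Proof.
move=> d; case: i => [[|[|//]] ?] /=; rewrite d ?mulf_neq0 //= ?pnatr_eq0 //.
Qed.

Lemma ycoord_continuous s i : continuous (@ycoord s ^~ i).
Proof. exact: coord_continuous. Qed.

Lemma is_derive_ycoord s i (x v : 'M[R]_(s.+1, 2)) :
  is_derive x v (@ycoord s ^~ i) (ycoord v i).
Proof. by apply: is_derive_linear => a z t; rewrite /ycoord !mxE. Qed.

Definition det_dom s : set 'M[R]_(s.+1, 2) :=
  [set y | eval (ycoord y) det_expr != 0].

Lemma open_det_dom s : open (@det_dom s).
Proof.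
rewrite (_ : @det_dom s = [set y | wd (ycoord y) (Inv det_expr)]) //.
by apply: open_wd => i; exact: ycoord_continuous.
Qed.

Definition row_eval s p (e : 'I_p -> rexpr R jvar) (y : 'M[R]_(s.+1, 2)) :
  'rV[R]_p := \row_i eval (ycoord y) (e i).

Lemma smooth_row_eval s p (e : 'I_p -> rexpr R jvar) :
  (forall c i, eval c det_expr != 0 -> wd c (e i)) ->
  smooth_on (@det_dom s) (row_eval e).
Proof.
move=> we k.
apply: (@Ck_eval _ _ _ _ (@ycoord_continuous s) (@is_derive_ycoord s) _ _ _
  (fun i : 'I_p => delta_mx 0 i) _ e).
- exact: open_det_dom.
- by move=> z dz i; exact: we.
- move=> z _; rewrite [LHS]row_sum_delta.
  by apply: eq_bigr => i _; rewrite mxE.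
Qed.

End Inversion.

(** * Generic jets and flatness *)

Section Main.
Variable R : realType.

(** The determinant w'' + w'^3 as a function of the jet. *)
Definition gen_expr : rexpr R ('I_3 + nat * 'I_2) :=
  (slope R 2 + slope R 1 * slope R 1 * slope R 1)%RE.

Definition generic_jets k : set (jet R 3 k) :=
  [set z | jet_dom (@example_dom R) z /\ eval (jcoord z) gen_expr != 0].

Lemma regular_gen : regular gen_expr.
Proof.
rewrite /gen_expr; move: (slope R) (@regular_slope R) => s rs c u0.
by rewrite /= !rs.
Qed.

Lemma open_generic_jets k : open (@generic_jets k).
Proof.
rewrite (_ : @generic_jets k = @jet_dom R 3 (@example_dom R) k `&`
                               [set z | wd (jcoord z) (Inv gen_expr)]).
  apply: openI; first exact: open_example_jet_dom.
  by apply: open_wd => i; exact: jcoord_continuous.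
apply/seteqP; split=> z [zD dz]; split=> //; last by case/andP: dz.
by apply/andP; split=> //; apply: regular_gen; exact/example_jet_domE.
Qed.

(** Of w and its first two derivatives only w'' involves u2'', and it does so
    through the term u2'' / u1. *)
Lemma gen_expr_shift (c c0 : 'I_3 + nat * 'I_2 -> R) t :
  c0 (inr (0%N, 0)) != 0 ->
  (forall l j, (l <= 2)%N ->
     c (inr (l, j)) = c0 (inr (l, j)) + t * ((l == 2%N) && (j == 1))%:R) ->
  eval c gen_expr = eval c0 gen_expr + t / c0 (inr (0%N, 0)).
Proof.
move=> u0 ct; rewrite /gen_expr /slope /= !ct //= !mulr0 !addr0 mulr1.
by field.
Qed.

(** At a jet where w'' + w'^3 vanishes, any nonzero change of u2'' makes it
    nonzero. *)
Lemma dense_generic_jets k : (2 <= k)%N ->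
  @jet_dom R 3 (@example_dom R) k `<=` closure (@generic_jets k).
Proof.
move=> k2 z zD B Bz.
pose D z := eval (@jcoord R 3 k z) gen_expr.
have [D0|D0] := eqVneq (D z) 0; last first.
  by exists z; split; [split|exact: nbhs_singleton].
pose e : jet R 3 k := (0, delta_mx (inord 2) 1).
pose p t := z + t *: e.
have pc : p t @[t --> 0^'] --> z.
  apply: cvg_within_filter.
  have : p t @[t --> (0 : R)] --> z + 0 *: e.
    by apply: cvgD; [exact: cvg_cst|apply: cvgZr_tmp; exact: cvg_id].
  by rewrite scale0r addr0.
have pE t i : jcoord (p t) i = jcoord z i + t * jcoord e i.
  by case: i => [i|[l j]]; rewrite /= !mxE.
have e2 l j : (l <= k)%N -> jcoord e (inr (l, j)) = ((l == 2%N) && (j == 1))%:R.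
  by move=> lk; rewrite /= mxE -val_eqE /= !inordK //.
have [u0 _] := example_jet_domE z; have {}u0 := u0 zD.
have DE t : D (p t) = t / jcoord z (inr (0%N, 0)).
  rewrite -[RHS]add0r -D0; apply: gen_expr_shift => // l j l2.
  by rewrite pE e2 // (leq_trans l2).
have nearB : \forall t \near 0^', B (p t) by apply: pc.
have : \forall t \near (0 : R)^', B (p t) /\ t != 0.
  near=> t; split; near: t => //; exact: nbhs_dnbhs_neq.
case/filter_ex=> t [Bt t0]; exists (p t); split => //; split.
  apply/example_jet_domE; rewrite pE e2 // andbF mulr0 addr0 //.
by rewrite -/(D _) DE mulf_neq0 ?invr_neq0.
Unshelve. all: by end_near. Qed.

Lemma output_jetE s m b j (z : jet R 3 m) : (b.+1 <= m)%N -> (b < s.+1)%N ->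
  jet_dom (@example_dom R) z ->
  ycoord (output_jet (@example_rhs R) (@example_output R) s.+1 z) (b, j) =
  eval (jcoord z)
    (iter b (fder (prolong (@rhs_expr R))) (output_expr R j)).
Proof.
move=> bm bs zD; rewrite /ycoord mxE /= inordK //.
have oj : all_vars (order_le 1) (output_expr R j).
  by rewrite /output_expr; case: ifP.
have rj := @regular_output R j.
rewrite (time_derivn_eval (e := output_expr R j)) //.
- apply: (@eval_ext _ _ (order_le (b + 1))).
    by elim: (b) => //= a; exact: order_tder.
  by move=> i ib; rewrite jcoord_trunc // addn1.
- by move=> z'; exact: example_outputE.
- apply/example_jet_domE; rewrite jcoord_trunc ?addn1 //.
  exact/example_jet_domE.
Qed.

Lemma eval_det_expr c (Y : nat * 'I_2 -> R) :
  (forall b, (b <= 2)%N -> Y (b, 0) = eval c (slope R b)) ->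
  eval Y (det_expr R) = eval c gen_expr.
Proof.
rewrite /gen_expr; move: (slope R) => s Yw.
by rewrite /= !Yw.
Qed.

Lemma eval_x_of c (Y : nat * 'I_2 -> R) i :
  eval c gen_expr != 0 ->
  (forall b, (b <= 3)%N -> Y (b, 0) = eval c (slope R b)) ->
  Y (0%N, 1) = eval c (y2_expr R) -> Y (1%N, 1) = eval c (dy2_expr R) ->
  Y (2%N, 1) = eval c (ddy2_expr R) ->
  eval Y (x_of R i) = c (inl i).
Proof.
rewrite /gen_expr /y2_expr /dy2_expr /ddy2_expr /A_expr /B_expr.
move: (slope R) => s /= d Yw Y0 Y1 Y2.
case: i => [[|[|[|//]]] iP]; rewrite /= Y0 Y1 Y2 !Yw //=.
- by rewrite (_ : Ordinal iP = 0); [field|exact: val_inj].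
- by rewrite (_ : Ordinal iP = 1); [field|exact: val_inj].
- by rewrite (_ : Ordinal iP = 2); [field|exact: val_inj].
Qed.

Lemma eval_u_of c (Y : nat * 'I_2 -> R) j :
  c (inr (0%N, 0)) != 0 -> eval c gen_expr != 0 ->
  (forall b, (b <= 4)%N -> Y (b, 0) = eval c (slope R b)) ->
  Y (0%N, 1) = eval c (y2_expr R) -> Y (1%N, 1) = eval c (dy2_expr R) ->
  Y (2%N, 1) = eval c (ddy2_expr R) -> Y (3%N, 1) = eval c (dddy2_expr R) ->
  eval Y (u_of R j) = c (inr (0%N, j)).
Proof.
move=> /slope0_eval; rewrite /gen_expr /y2_expr /dy2_expr /ddy2_expr.
rewrite /dddy2_expr /A_expr /B_expr; move: (slope R) => s /= s0 d Yw Y0 Y1 Y2 Y3.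
case: j => [[|[|//]] jP]; rewrite /= Y0 Y1 Y2 Y3 !Yw //=.
- by rewrite (_ : Ordinal jP = 0); [field|exact: val_inj].
- by rewrite (_ : Ordinal jP = 1) ?s0; [field|exact: val_inj].
Qed.

Lemma control_system_example : control_system (@example_dom R) (@example_rhs R).
Proof.
(* A point (x, u) is a jet of order 0. *)
have domE : @example_dom R = @jet_dom R 3 (@example_dom R) 0.
  by apply/seteqP; split=> z; rewrite /jet_dom /example_dom /= mxE.
split.
- by rewrite domE; exact: open_example_jet_dom.
- by exists (0, const_mx 1); rewrite /example_dom /= mxE oner_neq0.
- move=> k; apply: (@Ck_eval _ _ _ _ (@jcoord_continuous R 3 0)
    (@is_derive_jcoord R 3 0) _ _ _ (fun i : 'I_3 => delta_mx 0 i) _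
    (@rhs_expr R)).
  + by rewrite domE; exact: open_example_jet_dom.
  + rewrite domE => z /example_jet_domE zD i; exact: wd_rhs.
  + move=> z _; rewrite [LHS]row_sum_delta; apply: eq_bigr => i _.
    rewrite rhs_exprE; congr (example_rhs _ _ _ *: _).
    case: z => x u; congr (_, _); apply/rowP => j.
    by rewrite mxE.
Qed.

Lemma smooth_example_output j :
  smooth_on (@jet_dom R 3 (@example_dom R) 1) (@example_output R j).
Proof.
move=> k; apply: (@Ck_eval _ _ _ _ (@jcoord_continuous R 3 1)
  (@is_derive_jcoord R 3 1) R _ 1%N (fun=> 1) _ (fun=> output_expr R j)).
- exact: open_example_jet_dom.
- by move=> z /example_jet_domE zD _; exact: regular_output.
- by move=> z zD; rewrite big_ord1 example_outputE // /GRing.scale /= mulr1.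
Qed.

Lemma flat_output_example :
  flat_output (q := 1) (@example_dom R) (@example_rhs R) (@example_output R).
Proof.
split; first exact: control_system_example.
(* x needs y1''', and u needs y1'''' and y2'''. *)
exists 4%N, (@generic_jets 5); split.
- exact: open_generic_jets.
- by move=> z [].
- exact: dense_generic_jets.
move=> z0 z0V; exists (@generic_jets 5); split=> //.
- exact: open_generic_jets.
- by move=> z [].
- move=> j k; apply: Ck_on_subset (smooth_example_output j k).
  move=> _ [z [zD _] <-]; apply/example_jet_domE.
  by rewrite jcoord_trunc //; exact/example_jet_domE.
have Yw s (z : jet R 3 5) b : generic_jets z -> (b <= s)%N -> (b <= 4)%N ->
    ycoord (output_jet (@example_rhs R) (@example_output R) s.+1 z) (b, 0) =
    eval (jcoord z) (slope R b).
  by move=> [zD _] bs b4; rewrite output_jetE.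
have Yy s (z : jet R 3 5) b : generic_jets z -> (b <= s)%N -> (b <= 4)%N ->
    ycoord (output_jet (@example_rhs R) (@example_output R) s.+1 z) (b, 1) =
    eval (jcoord z) (iter b (fder (prolong (@rhs_expr R))) (y2_expr R)).
  by move=> [zD _] bs b4; rewrite output_jetE.
have u_neq0 (z : jet R 3 5) : generic_jets z -> jcoord z (inr (0%N, 0)) != 0.
  by case=> /example_jet_domE.
split.
- exists (@det_dom R 3), (row_eval (x_of R)); split.
  + exact: open_det_dom.
  + by apply: smooth_row_eval => c i; exact: wd_x_of.
  move=> z zV; have dz := zV.2.
  have [d1 d2 _] := output_derivs (u_neq0 z zV); split.
    rewrite /det_dom /mkset (@eval_det_expr (jcoord z)) // => b b2.
    by rewrite Yw // (leq_trans b2).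
  apply/rowP => i; rewrite mxE (@eval_x_of (jcoord z)) ?Yy //.
  by move=> b b3; rewrite Yw // (leq_trans b3).
- exists (@det_dom R 4), (row_eval (u_of R)); split.
  + exact: open_det_dom.
  + by apply: smooth_row_eval => c i; exact: wd_u_of.
  move=> z zV; have [u0 dz] := (u_neq0 z zV, zV.2).
  have [d1 d2 d3] := output_derivs u0; split.
    rewrite /det_dom /mkset (@eval_det_expr (jcoord z)) // => b b2.
    by rewrite Yw // (leq_trans b2).
  apply/rowP => j; rewrite !mxE -jcoord0 (@eval_u_of (jcoord z)) ?Yy //.
  by move=> b b4; rewrite Yw.
Qed.
End Main.

Theorem mainTheorem3 (R : realType) :
  flat (@example_dom R) (@example_rhs R) /\
  flat_output (q := 1) (@example_dom R) (@example_rhs R) (@example_output R).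
Proof.
split; last exact: flat_output_example.
by exists 1%N, (@example_output R); exact: flat_output_example.
Qed.
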